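(* Let $1\le K'\le K$ and $N\ge1$ be integers. For a $(K,K',N)$ hotplug coded caching system, the lower convex envelope of the points $$\left(\frac{M}{N},R\right)=\left(\frac{\binom{K-1}{t-1}}{\binom{K'}{t}},\ \frac{\binom{K'}{t+1}-\left\lfloor\frac{K'}{t+1}\right\rfloor\left(\binom{K-1}{t-1}-\binom{K'-1}{t-1}\right)}{\binom{K'}{t}}\right),$$ over all $t\in\{0,1,\dots,K'\}$ with $\binom{K-1}{t-1}\le\binom{K'}{t}$ (i.e. $M\le N$), is achievable.
   Context: Convention: $\binom{n}{-1}=0$ and $\binom{n}{m}=0$ for $m>n$. Hotplug coded caching. In a $(K,K',N)$ hotplug coded caching system ($K'\le K$) a server stores $N$ files $W_1,\dots,W_N$, each of size $L$ bits, and is connected to $K$ users by an error-free shared link; each user has a cache of size $M$ files ($ML$ bits), $0\le M\le N$. In the placement phase the server fills the caches with functions of the files, knowing $K'$ but neither the identity of the $K'$ users who will be active nor the demands. In the delivery phase an arbitrary set $I\subseteq\{1,\dots,K\}$, $|I|=K'$, of active users reveals arbitrary demands $(d_i)_{i\in I}\in\{1,\dots,N\}^{I}$; the server broadcasts a message of size $RL$ bits, depending on the files, $I$ and the demands, such that each active user $i$ recovers $W_{d_i}$ from the message and its own cache. $R$ is the rate. The scheme must work for all files, all $I$ and all demands. A pair $(M/N,R)$ is achievable if, for file sizes $L$ taken large enough, there are schemes with cache size and rate equal to (or arbitrarily close to) $M$ and $R$. The lower convex envelope of finitely many points is the lower boundary of their convex hull. *)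

(* Defs.v *)
From mathcomp Require Import all_boot all_order all_algebra.
From mathcomp Require Import classical_sets reals convex.

Set Implicit Arguments.
Unset Strict Implicit.
Unset Printing Implicit Defensive.

Import Order.TTheory GRing.Theory Num.Theory.

Local Open Scope classical_set_scope.
Local Open Scope ring_scope.

Definition file (L : nat) := L.-tuple bool.

Definition library (N L : nat) := {ffun 'I_N -> file L}.

Definition demand (K N : nat) (I : {set 'I_K}) :=
  {ffun {i : 'I_K | i \in I} -> 'I_N}.

(* [c] and [r] are the cache and message sizes in bits.  The decoder sees
   neither the active set nor the demands: whatever a user needs to know about
   them has to be carried by the message and is charged to the rate. *)
Definition hotplug_scheme (K K' N L c r : nat)
    (place : 'I_K -> library N L -> c.-tuple bool)
    (deliver : forall I : {set 'I_K}, demand N I -> library N L ->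
       r.-tuple bool)
    (decode : 'I_K -> r.-tuple bool -> c.-tuple bool -> file L) : Prop :=
  forall (I : {set 'I_K}) (d : demand N I) (W : library N L)
         (i : {i : 'I_K | i \in I}),
    #|I| = K' ->
    decode (val i) (deliver I d W) (place (val i) W) = W (d i).

(* The pair [p] is (M / N, rate), so the cache size in files is M = N * p.1. *)
Definition achievable (R : realType) (K K' N : nat) : set (R * R) :=
  [set p | forall e : R, 0 < e ->
    exists L0 : nat, forall L : nat, (L0 <= L)%N ->
    exists c r : nat,
      [/\ (c <= N * L)%N,
          `|c%:R / L%:R - N%:R * p.1| <= e,
          `|r%:R / L%:R - p.2| <= e &
          exists place deliver decode,
            @hotplug_scheme K K' N L c r place deliver decode]].

Arguments achievable : clear implicits.

(* 'C(n, t - 1) with the convention 'C(n, -1) = 0, which truncated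
   subtraction would get wrong at t = 0. *)
Definition bin_pred (n t : nat) : nat := if t is t'.+1 then 'C(n, t') else 0%N.

Definition hotplug_point (R : realType) (K K' t : nat) : R * R :=
  ((bin_pred K.-1 t)%:R / 'C(K', t)%:R,
   ('C(K', t.+1)%:R -
      (K' %/ t.+1)%:R * ((bin_pred K.-1 t)%:R - (bin_pred K'.-1 t)%:R))
   / 'C(K', t)%:R).

Definition hotplug_points (R : realType) (K K' : nat) : set (R * R) :=
  [set hotplug_point R K K' t |
    t in [set t | (t <= K')%N /\ (bin_pred K.-1 t <= 'C(K', t))%N]].

Arguments hotplug_points : clear implicits.

Definition convex_hull (R : realType) (A : set (R * R)) : set (R * R) :=
  smallest (@convex_set R (R^o * R^o)%type) A.

Definition lower_convex_envelope (R : realType) (A : set (R * R)) :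
    set (R * R) :=
  [set p | convex_hull A p /\
     forall y : R, convex_hull A (p.1, y) -> p.2 <= y].

(* Main.v *)
(* Cut each file into 'C(K', t) blocks and encode them by an MDS code into one
   piece per subset of users (an evaluation of the polynomial over GF(2^m) whose
   coefficients are the blocks).  A user caches the pieces of the t-sets
   containing it, and a multicast to a (t+1)-set S of active users lets each i in
   S recover its wanted piece S minus i.  Pieces cached for t-sets that meet the
   offline users make some multicasts superfluous: an active user owns
   s = 'C(K-1, t-1) - 'C(K'-1, t-1) of them, so by the MDS property it can miss up
   to s multicasts.  Hence one may drop any family of (t+1)-sets in which every
   active user lies at most s times, and a balancing argument provides such a
   family of floor(K'/(t+1)) * s sets.  Memory sharing makes the achievable pairs
   a convex set, which therefore contains the whole convex hull. *)
Require Import Defs.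
From mathcomp Require Import classical_sets reals convex.
From mathcomp Require Import all_boot all_order all_algebra all_field.
From mathcomp Require Import zify ring lra.

Set Implicit Arguments.
Unset Strict Implicit.
Unset Printing Implicit Defensive.

Import Order.TTheory GRing.Theory Num.Theory.

(** * Degrees in families of finite sets, and balancing them *)

Definition degree (T : finType) (H : {set {set T}}) (x : T) :=
  #|[set S in H | x \in S]|.

Lemma degreeU1 (T : finType) (H : {set {set T}}) (S : {set T}) x :
  S \notin H -> degree (S |: H) x = (x \in S) + degree H x.
Proof.
move=> SH; rewrite /degree; have [xS|xS] := boolP (x \in S).
  rewrite (_ : [set _ in _ | _] = S |: [set S' in H | x \in S']).
    by rewrite cardsU1 inE (negPf SH).
  by apply/setP=> S'; rewrite !inE; case: eqP => // ->.
apply: eq_card => S'; rewrite !inE.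
rewrite andb_orl; case: eqP => [->|_]; by rewrite ?(negPf xS).
Qed.

Lemma degreeD1 (T : finType) (H : {set {set T}}) (S : {set T}) x :
  S \in H -> degree H x = (x \in S) + degree (H :\ S) x.
Proof. by move=> SH; rewrite -[in LHS](setD1K SH) degreeU1 ?setD11. Qed.

Lemma sum_degree (T : finType) (A : {set T}) (k : nat) (H : {set {set T}}) :
    {in H, forall S : {set T}, S \subset A /\ #|S| = k} ->
  \sum_(x in A) degree H x = #|H| * k.
Proof.
move=> HA; under eq_bigr do rewrite /degree -sum1dep_card big_mkcondr.
rewrite exchange_big -sum_nat_const /=; apply: eq_bigr => S /HA[SA <-].
rewrite -big_mkcondr /= sum1dep_card; apply: eq_card => x.
by rewrite inE andb_idl //; apply: (subsetP SA).
Qed.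

(* Otherwise exchanging [x] for [y] would embed the edges through [x] into the
   edges through [y]. *)
Lemma exchange_edge (T : finType) (H : {set {set T}}) (x y : T) :
    degree H y < degree H x ->
  exists2 S : {set T}, S \in H &
    [/\ x \in S, y \notin S & y |: S :\ x \notin H].
Proof.
move=> lt_yx.
suff /exists_inP[S SH /and3P[]] :
    [exists S in H, [&& x \in S, y \notin S & y |: S :\ x \notin H]].
  by exists S.
apply: contraLR lt_yx => /exists_inPn noS.
pose f (S : {set T}) := if y \in S then S else y |: S :\ x.
(* An image of [f] still contains [x] exactly when [S] was left unchanged, so the two branches
   cannot collide. *)
have f_inj : {in [set S in H | x \in S] &, injective f}.
  move=> S1 S2; rewrite !inE /f => /andP[_ xS1] /andP[_ xS2].
  have xy (S : {set T}) : y \notin S -> x \in S -> x == y = false.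
    by move=> yS xS; apply: contraNF yS => /eqP <-.
  case: (boolP (y \in S1)) => yS1; case: (boolP (y \in S2)) => yS2 //.
  - by move=> eS; move: xS1; rewrite eS !inE eqxx (xy _ yS2 xS2).
  - by move=> eS; move: xS2; rewrite -eS !inE eqxx (xy _ yS1 xS1).
  move=> /setP eS; apply/setP => z; move: (eS z); rewrite !inE.
  have [->|_] := eqVneq z y; first by rewrite (negPf yS1) (negPf yS2).
  by have [->|_] := eqVneq z x; rewrite ?xS1 ?xS2.
rewrite -leqNgt /degree -(card_in_imset f_inj).
apply/subset_leq_card/subsetP => _ /imsetP[S + ->]; rewrite inE => /andP[SH xS].
have := noS _ SH; rewrite /f !inE xS /=; case: (boolP (y \in S)) => yS.
  by rewrite SH yS.
by rewrite negbK setU11 => ->.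
Qed.

(** Among the families of [m] subsets of size [k], one of least total excess over [D] works: a
    vertex above [D] would coexist with one below [D], and exchanging them in one edge would lower
    the excess. *)
Lemma bounded_degree_family (T : finType) (A : {set T}) (k m D : nat) :
    m <= 'C(#|A|, k) -> m * k <= D * #|A| ->
  exists H : {set {set T}},
    [/\ #|H| = m, {in H, forall S : {set T}, S \subset A /\ #|S| = k}
      & {in A, forall x, degree H x <= D}].
Proof.
move=> le_mC le_mkD; pose U := [set S : {set T} | S \subset A & #|S| == k].
pose P (H : {set {set T}}) := (H \subset U) && (#|H| == m).
have PU H : P H -> {in H, forall S : {set T}, S \subset A /\ #|S| = k}.
  by move=> /andP[/subsetP HU _] S /HU; rewrite inE => /andP[? /eqP].
have [H0 PH0] : exists H0, P H0.
  apply/existsP; rewrite -cards_draws -/U in le_mC.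
  have : 0 < #|[set H : {set {set T}} | (H \subset U) & (#|H| == m)]|.
    by rewrite cards_draws bin_gt0.
  by case/card_gt0P => H; rewrite inE => ?; apply/existsP; exists H.
pose excess (H : {set {set T}}) := \sum_(x in A) (degree H x - D).
case: (@arg_minnP _ H0 P excess PH0) => H PH minH.
exists H; split; [by case/andP: PH => _ /eqP| exact: PU |].
move=> x xA; rewrite leqNgt; apply/negP => ltDx.
(* Otherwise the degrees would sum to more than [D * #|A|], while they sum to [m * k]. *)
have [y yA ltyD] : exists2 y, y \in A & degree H y < D.
  apply/exists_inP; apply: contraLR le_mkD => /exists_inPn geD.
  rewrite -ltnNge -(eqP (proj2 (andP PH))) -(sum_degree (PU _ PH)).
  rewrite mulnC -sum_nat_const; rewrite !(bigD1 x xA) /= -addSn leq_add //.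
  apply: leq_sum => y /andP[yA _]; rewrite leqNgt; exact: geD.
have [S SH [xS yS S'H]] := exchange_edge (ltn_trans ltyD ltDx).
set S' := y |: S :\ x in S'H; pose H' := S' |: H :\ S.
have S'HS : S' \notin H :\ S by rewrite inE (negPf S'H) andbF.
have [SA kS] := PU _ PH _ SH.
have PH' : P H'.
  apply/andP; split.
    apply/subsetP => X; rewrite 2!inE => /orP[/eqP->|/setD1P[_ XH]].
      rewrite inE /S' subUset sub1set yA (subset_trans (subD1set _ _)) //=.
      by rewrite cardsU1 !inE (negPf yS) andbF /= -kS (cardsD1 x S) xS.
    by rewrite inE; have [-> ->] := PU _ PH _ XH; rewrite eqxx.
  rewrite cardsU1 S'HS /=; have := cardsD1 S H.
  by rewrite SH => <-; case/andP: PH.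
have degE z : degree H' z + (z \in S) = degree H z + (z \in S').
  by rewrite degreeU1 // (degreeD1 z SH) addnC [_ + degree _ _]addnC addnA.
have neq_xy : x == y = false by apply: contraNF yS => /eqP <-.
(* The degree of [x] drops by one from above [D]; that of [y] rises by one but stays at most [D];
   the others do not move. *)
have := minH _ PH'; apply/negP; rewrite -ltnNge /excess.
rewrite [in X in X < _](bigD1 x xA) [in X in _ < X](bigD1 x xA) /= -addSn.
apply: leq_add.
  have := degE x; rewrite xS !inE neq_xy eqxx addn1 addn0 => degx.
  by move: ltDx; rewrite -degx ltnS => /subSn->.
apply: leq_sum => z /andP[_ zx]; have := degE z.
rewrite !inE zx /=; have [->|_ /addIn->//] := eqVneq z y.
rewrite (negPf yS) addn0 addn1 => ->.
by move: ltyD; rewrite -subn_eq0 => /eqP->.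
Qed.

(** * Counting subsets and choosing the multicasts to send *)

Lemma card_draws_mem (T : finType) (A : {set T}) (x : T) (k : nat) : x \in A ->
  #|[set S : {set T} | [&& S \subset A, #|S| == k & x \in S]]|
    = bin_pred #|A|.-1 k.
Proof.
move=> xA; case: k => [|k] /=.
  apply: eq_card0 => S; rewrite !inE cards_eq0.
  by apply/negP => /and3P[_ /eqP->]; rewrite inE.
have := cardsD1 x A; rewrite xA => /= ->; rewrite -cards_draws.
set U := [set S : {set T} | _].
have f_inj : {in U &, injective (fun S : {set T} => S :\ x)}.
  move=> S1 S2; rewrite !inE => /and3P[_ _ x1] /and3P[_ _ x2] e12.
  by rewrite -(setD1K x1) e12 setD1K.
rewrite -(card_in_imset f_inj).
apply: eq_card => S; rewrite !inE; apply/imsetP/andP => [[X + ->]|].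
  rewrite inE => /and3P[XA /eqP cX xX]; rewrite setSD //; split => //.
  by have := cardsD1 x X; rewrite xX cX => -[->].
move=> [/subsetD1P[SA xS] /eqP cS]; exists (x |: S).
  by rewrite inE setU11 cardsU1 xS cS subUset sub1set xA SA eqxx.
by rewrite setU1K.
Qed.

Lemma degreeD (T : finType) (H D : {set {set T}}) x : D \subset H ->
  degree (H :\: D) x = degree H x - degree D x.
Proof.
move=> DH; rewrite /degree.
rewrite (_ : [set S in H :\: D | _] =
             [set S in H | x \in S] :\: [set S in D | x \in S]).
  rewrite cardsD (setIidPr _) //; apply/subsetP => S; rewrite !inE.
  by move=> /andP[/(subsetP DH)-> ->].
by apply/setP => S; rewrite !inE; case: (x \in S); rewrite ?andbT ?andbF.
Qed.

Lemma leq_bin_pred (m n t : nat) : m <= n -> bin_pred m t <= bin_pred n t.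
Proof. by case: t => //= t; apply: leq_bin2l. Qed.

Lemma binE_pred (n t : nat) : 0 < n -> 'C(n, t) = 'C(n.-1, t) + bin_pred n.-1 t.
Proof. by case: n t => // n [|t] _; rewrite ?bin0 //= binS. Qed.

(** The number of t-sets containing a given active user and meeting the offline users. *)
Definition skipped (K K' t : nat) : nat := bin_pred K.-1 t - bin_pred K'.-1 t.

(** There are enough (t+1)-sets to drop: Pascal's rule bounds [skipped K K' t] by ['C(K'.-1, t)],
    and [t.+1 * 'C(K', t.+1) = K' * 'C(K'.-1, t)]. *)
Lemma leq_skipped (K K' t : nat) : 0 < K' ->
    bin_pred K.-1 t <= 'C(K', t) ->
  K' %/ t.+1 * skipped K K' t <= 'C(K', t.+1).
Proof.
move=> K'_gt0 le_k; have le_sC : skipped K K' t <= 'C(K'.-1, t).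
  by rewrite leq_subLR addnC -binE_pred.
rewrite -(leq_pmul2l (ltn0Sn t)) -mul_bin_diag mulnA (mulnC t.+1).
exact: leq_mul (leq_trunc_div _ _) le_sC.
Qed.

(** [G] holds the multicasts that are sent. The last clause says that cached pieces and received
    multicasts together reach the MDS threshold: each active user lies in ['C(K'.-1, t)] of the
    (t+1)-subsets of [I] and loses at most [s] of them. *)
Lemma multicast_family (T : finType) (I : {set T}) (K K' t : nat) :
    #|I| = K' -> 0 < K' -> K' <= K -> bin_pred K.-1 t <= 'C(K', t) ->
  exists G : {set {set T}},
    [/\ #|G| = 'C(K', t.+1) - K' %/ t.+1 * skipped K K' t,
        {in G, forall S : {set T}, #|S| = t.+1}
      & {in I, forall i, 'C(K', t) <= bin_pred K.-1 t + degree G i}].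
Proof.
move=> cI K'_gt0 le_K'K le_k; set s := skipped K K' t.
have [||D [cD DU degD]] := @bounded_degree_family T I t.+1 (K' %/ t.+1 * s) s.
- by rewrite cI leq_skipped.
- by rewrite cI mulnAC mulnC leq_mul // leq_trunc_div.
pose U := [set S : {set T} | S \subset I & #|S| == t.+1].
have {DU} DU : D \subset U.
  by apply/subsetP => S /DU[SI cS]; rewrite inE SI cS eqxx.
exists (U :\: D); split.
- by rewrite cardsD (setIidPr DU) cD cards_draws cI.
- by move=> S; rewrite !inE => /and3P[_ _ /eqP].
move=> i iI; rewrite degreeD //; have := degD i iI.
have -> : degree U i = 'C(K'.-1, t).
  rewrite -[RHS]/(bin_pred K'.-1 t.+1) -cI -(card_draws_mem t.+1 iI).
  by apply: eq_card => S; rewrite !inE andbA.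
have := leq_bin_pred t (leq_sub2r 1 le_K'K).
by rewrite !subn1 /s /skipped (binE_pred t K'_gt0); lia.
Qed.

(** * Decoders by search, and the MDS code *)

Lemma card_inj (A B : finType) : #|A| <= #|B| -> exists f : A -> B, injective f.
Proof.
move=> leAB; exists (fun a => enum_val (widen_ord leAB (enum_rank a))) => a b.
by move=> /enum_val_inj/(congr1 val)/= /val_inj/enum_rank_inj.
Qed.

(* A decoder can be found by search as soon as cache and message determine the
   wanted file, whatever the active set and the demands are. *)
Lemma hotplug_scheme_exists (K K' N L c r : nat) (C M : finType)
    (place : 'I_K -> library N L -> C)
    (deliver : forall I : {set 'I_K}, demand N I -> library N L -> M) :
    #|C| <= 2 ^ c -> #|M| <= 2 ^ r ->
    (forall (I I' : {set 'I_K}) (d : demand N I) (d' : demand N I')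
        (W W' : library N L) (i : {i | i \in I}) (i' : {i | i \in I'}),
      #|I| = K' -> #|I'| = K' -> val i = val i' ->
      place (val i) W = place (val i) W' -> deliver I d W = deliver I' d' W' ->
      W (d i) = W' (d' i')) ->
  exists place' deliver' decode',
    @hotplug_scheme K K' N L c r place' deliver' decode'.
Proof.
move=> leC leM det.
have [|f f_inj] := @card_inj C (c.-tuple bool).
  by rewrite card_tuple card_bool.
have [|g g_inj] := @card_inj M (r.-tuple bool).
  by rewrite card_tuple card_bool.
pose ok (i : 'I_K) (m : r.-tuple bool) (x : c.-tuple bool) (w : file L) :=
  [exists I : {set 'I_K}, [exists d : demand N I, [exists W : library N L,
   [exists j : {i | i \in I},
     [&& #|I| == K', val j == i, g (deliver I d W) == m,
         f (place i W) == x & W (d j) == w]]]]].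
exists (fun i W => f (place i W)), (fun I d W => g (deliver I d W)),
  (* The default word is never returned on a message and cache arising from an active set of size
     [K']. *)
  (fun i m x => odflt (nseq_tuple L false) [pick w | ok i m x w]).
move=> I d W i cI; case: pickP => [w|none]; last first.
  suff : ok (val i) (g (deliver I d W)) (f (place (val i) W)) (W (d i)).
    by rewrite none.
  apply/existsP; exists I; apply/existsP; exists d.
  by apply/existsP; exists W; apply/existsP; exists i; rewrite cI !eqxx.
move=> /existsP[I' /existsP[d' /existsP[W' /existsP[i' /and5P[]]]]].
move=> /eqP cI' /eqP ii' /eqP /g_inj eM /eqP /f_inj eC /eqP <- /=.
by apply: (det I' I d' d W' W i' i cI' cI ii') => //; rewrite ii'.
Qed.

(** A Reed-Solomon code: distinct polynomials of size at most [k] agree on fewer than [k] evaluation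
    points, and [#|X| <= 2 ^ m] provides a separate point for each index. *)
Lemma mds_code (X A : finType) (k m : nat) :
    0 < m -> #|X| <= 2 ^ m -> #|A| <= 2 ^ (m * k) ->
  exists2 F : finZmodType, #|F| = 2 ^ m &
  exists h : A -> X -> F, forall (w w' : A) (Z : {set X}),
    k <= #|Z| -> {in Z, h w =1 h w'} -> w = w'.
Proof.
move=> m_gt0 leX leA; have [F _ cF] := pPrimePowerField (isT : prime 2) m_gt0.
exists F => //.
have [|a a_inj] := @card_inj X F; first by rewrite cF.
have [|f f_inj] := @card_inj A 'rV[F]_k.
  by rewrite card_mx cF mul1n -expnM.
exists (fun w x => (rVpoly (f w)).[a x])%R => w w' Z leZ eqZ.
apply: f_inj; apply: (can_inj rVpolyK); apply/eqP; rewrite -subr_eq0.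
apply: contraLR leZ => p_neq0; rewrite -ltnNge cardE -(size_map a).
apply: leq_trans (_ : size (rVpoly (f w) - rVpoly (f w'))%R <= k); last first.
  by rewrite -raddfB /=; apply: size_poly.
apply: max_poly_roots => //; last by rewrite map_inj_uniq ?enum_uniq.
apply/allP => _ /mapP[x + ->]; rewrite mem_enum => xZ.
by rewrite rootE hornerD hornerN eqZ // subrr.
Qed.

(** * The scheme for a fixed file size *)

Lemma eq_on_enum (Y : Type) (T : finType) (x0 : T) (n : nat) (Z : {set T})
    (f g : T -> Y) :
    #|Z| = n ->
    (forall j : 'I_n, f (nth x0 (enum Z) j) = g (nth x0 (enum Z) j)) ->
  {in Z, f =1 g}.
Proof.
move=> cZ efg x xZ; have := xZ; rewrite -mem_enum -index_mem -cardE cZ => ltx.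
by have := efg (Ordinal ltx); rewrite /= nth_index ?mem_enum.
Qed.

(* The decoder has to learn the active set and the demands from the message;
   this costs a number of bits that does not depend on the file size. *)
Definition request (K N : nat) : finType :=
  {I : {set 'I_K} & {ffun {i : 'I_K | i \in I} -> 'I_N}}.

(* The minimum is needed because of the rounding in L <= m * 'C(K', t): when the
   cached pieces exceed N * L bits, users store the uncoded library instead. *)
Lemma coded_hotplug_scheme (K K' N L t m : nat) :
    0 < K' -> K' <= K -> bin_pred K.-1 t <= 'C(K', t) ->
    0 < m -> K <= m -> L <= m * 'C(K', t) ->
  exists place deliver decode,
    @hotplug_scheme K K' N L (minn (m * (N * bin_pred K.-1 t)) (N * L))
      (#|request K N| + m * ('C(K', t.+1) - K' %/ t.+1 * skipped K K' t))
      place deliver decode.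
Proof.
move=> K'_gt0 le_K'K le_k m_gt0 le_Km le_L.
set B := bin_pred K.-1 t in le_k *; set E := (_ - _ * _).
set A := #|request K N|.
have [||F cF [h hP]] := @mds_code {set 'I_K} (file L) 'C(K', t) m m_gt0.
- by rewrite -cardsT -powersetT card_powerset cardsT card_ord leq_exp2l.
- by rewrite card_tuple card_bool leq_exp2l.
(* The family is chosen from [I] alone, so a user who learns [I] from the message knows which
   multicasts were sent. *)
have family (I : {set 'I_K}) : exists GI : {set {set 'I_K}}, #|I| = K' ->
    [/\ #|GI| = E, {in GI, forall S : {set 'I_K}, #|S| = t.+1}
      & {in I, forall i, 'C(K', t) <= B + degree GI i}].
  have [/multicast_family|neq] := eqVneq #|I| K'; last first.
    by exists set0 => /eqP; rewrite (negPf neq).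
  by move=> /(_ K t K'_gt0 le_K'K le_k) [GI ?]; exists GI.
have {family} [G GP] := fin_all_exists family.
pose Q (i : 'I_K) :=
  [set T : {set 'I_K} | [&& T \subset setT, #|T| == t & i \in T]].
have cQ i : #|Q i| = B by rewrite card_draws_mem ?inE // cardsT card_ord.
pose store (i : 'I_K) (W : library N L) :=
  [ffun p : 'I_N * 'I_B => h (W p.1) (nth set0 (enum (Q i)) p.2)].
pose sum_at (I : {set 'I_K}) (d : demand N I) (W : library N L)
    (S : {set 'I_K}) : F :=
  (\sum_(j : {i | i \in I} | val j \in S) h (W (d j)) (S :\ val j))%R.
pose deliver (I : {set 'I_K}) (d : demand N I) (W : library N L) :
    request K N * {ffun 'I_E -> F} :=
  (Tagged (fun I : {set 'I_K} => {ffun {i : 'I_K | i \in I} -> 'I_N}) d,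
   [ffun e : 'I_E => sum_at I d W (nth set0 (enum (G I)) e)]).
have leM : #|{: request K N * {ffun 'I_E -> F}}| <= 2 ^ (A + m * E).
  rewrite card_prod card_ffun card_ord cF -expnM expnD.
  by rewrite leq_mul2r orbC (ltnW (ltn_expl _ _)).
have det (I I' : {set 'I_K}) (d : demand N I) (d' : demand N I')
    (W W' : library N L) (i : {i | i \in I}) (i' : {i | i \in I'}) :
    #|I| = K' -> val i = val i' -> store (val i) W = store (val i) W' ->
  deliver I d W = deliver I' d' W' -> W (d i) = W' (d' i').
  (* The request part of the message identifies [I'] with [I] and [d'] with [d]. *)
  move=> cI ii' /ffunP eqC eqM; have /= eqR := congr1 fst eqM.
  have /= eI := congr1 tag eqR; move: d' i' ii' eqM eqR.
  rewrite -{}eI => d' i' /val_inj <- eqM eqR.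
  have dd' := eq_from_Tagged eqR.
  move: eqM; rewrite -{d' eqR}dd' => /(congr1 snd)/= /ffunP eqM.
  have [cG sizeG degG] := GP I cI.
  have eqQ n : {in Q (val i), h (W n) =1 h (W' n)}.
    apply: (eq_on_enum (x0 := set0) (cQ _)) => j.
    by have := eqC (n, j); rewrite !ffunE.
  have eqG : {in G I, sum_at I d W =1 sum_at I d W'}.
    apply: (eq_on_enum (x0 := set0) cG) => e.
    by have := eqM e; rewrite !ffunE.
  have eqi S : S \in G I -> val i \in S ->
      h (W (d i)) (S :\ val i) = h (W' (d i)) (S :\ val i).
    move=> SG iS; have := eqG S SG; rewrite /sum_at !(bigD1 i iS) /=.
    (* Every other summand is indexed by [S] minus [j], a t-set containing [i]; it is cached by [i],
       so it cancels. *)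
    rewrite (eq_bigr (fun j => h (W' (d j)) (S :\ val j))).
      by move/addIr.
    move=> j /andP[jS ji]; apply: eqQ; rewrite !inE subsetT iS.
    rewrite andbT /= (inj_eq val_inj) [i == j]eq_sym ji andbT.
    by have := cardsD1 (val j) S; rewrite jS sizeG // add1n => -[<-].
  pose GQ := [set S :\ val i | S in [set S in G I | val i \in S]].
  apply: (hP _ _ (Q (val i) :|: GQ)); last first.
    move=> T; rewrite in_setU => /orP[/eqQ->//|/imsetP[S + ->]].
    by rewrite inE => /andP[SG iS]; apply: eqi.
  (* Cached indices contain [i] and those recovered from multicasts do not, so the two counts add
     up. *)
  rewrite cardsU (_ : _ :&: _ = set0) ?cards0 ?subn0; last first.
    apply/setP => T; rewrite !inE; apply/negP => /andP[/and3P[_ _ iT]].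
    by case/imsetP => S _ eT; rewrite eT !inE eqxx in iT.
  rewrite cQ card_in_imset; first exact: degG (valP i).
  move=> S1 S2; rewrite !inE => /andP[_ x1] /andP[_ x2] e12.
  by rewrite -(setD1K x1) e12 setD1K.
have [le_c|lt_c] := leqP (m * (N * B)) (N * L).
  apply: (@hotplug_scheme_exists _ _ _ _ _ _ _ _ store deliver _ leM).
    by rewrite card_ffun card_prod !card_ord cF -expnM.
  by move=> *; apply: det.
apply: (@hotplug_scheme_exists _ _ _ _ _ _ _ _ (fun _ W => W) deliver _ leM).
  by rewrite card_ffun card_tuple card_bool card_ord -expnM mulnC.
move=> I I' d d' W W' i i' cI _ ii' -> eqM.
by apply: (det _ _ _ _ W' W').
Qed.

(** * Memory sharing *)

Lemma split_hotplug_scheme (K K' N L1 L2 c1 c2 r1 r2 : nat)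
    place1 deliver1 decode1 place2 deliver2 decode2 :
    @hotplug_scheme K K' N L1 c1 r1 place1 deliver1 decode1 ->
    @hotplug_scheme K K' N L2 c2 r2 place2 deliver2 decode2 ->
  exists place deliver decode,
    @hotplug_scheme K K' N (L1 + L2) (c1 + c2) (r1 + r2) place deliver decode.
Proof.
move=> ok1 ok2.
(* [g] stands for cutting a file in two; any injection will do, since the decoder is found by
   search. *)
have [|g g_inj] := @card_inj (file (L1 + L2)) (file L1 * file L2)%type.
  by rewrite card_prod !card_tuple card_bool expnD.
pose W1 (W : library N (L1 + L2)) : library N L1 := [ffun n => (g (W n)).1].
pose W2 (W : library N (L1 + L2)) : library N L2 := [ffun n => (g (W n)).2].
apply: (@hotplug_scheme_exists _ _ _ _ _ _
  (c1.-tuple bool * c2.-tuple bool)%type (r1.-tuple bool * r2.-tuple bool)%type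
  (fun i W => (place1 i (W1 W), place2 i (W2 W)))
  (fun I d W => (deliver1 I d (W1 W), deliver2 I d (W2 W)))).
- by rewrite card_prod !card_tuple card_bool expnD.
- by rewrite card_prod !card_tuple card_bool expnD.
move=> I I' d d' W W' i i' cI cI' ii' [eC1 eC2] [eM1 eM2]; apply: g_inj.
rewrite [LHS]surjective_pairing [RHS]surjective_pairing; congr (_, _).
  have := ok1 I' d' (W1 W') i' cI'; rewrite -ii' -eC1 -eM1 ok1 //.
  by rewrite !ffunE.
have := ok2 I' d' (W2 W') i' cI'; rewrite -ii' -eC2 -eM2 ok2 //.
by rewrite !ffunE.
Qed.

Local Open Scope ring_scope.

(** After multiplication by [L1 + L2], the error is the sum of the errors of the two parts and of
    [a - b] times the rounding error of [L1], which is at most one bit. *)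
Lemma mix_close (R : realFieldType) (x1 x2 L1 L2 a b l e : R) :
    0 < L1 -> 0 < L2 -> `|x1 / L1 - a| <= e / 2 -> `|x2 / L2 - b| <= e / 2 ->
    `|L1 - l * (L1 + L2)| <= 1 -> `|a - b| <= e / 2 * (L1 + L2) ->
  `|(x1 + x2) / (L1 + L2) - (l * a + (1 - l) * b)| <= e.
Proof.
move=> L1_gt0 L2_gt0 close1 close2 closeL closeab.
have L_gt0 := addr_gt0 L1_gt0 L2_gt0.
rewrite -(ler_pM2r L_gt0) -[X in `|_| * X](gtr0_norm L_gt0) -normrM.
have -> : ((x1 + x2) / (L1 + L2) - (l * a + (1 - l) * b)) * (L1 + L2) =
    (x1 / L1 - a) * L1 + (x2 / L2 - b) * L2 + (a - b) * (L1 - l * (L1 + L2)).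
  by field; rewrite ?lt0r_neq0.
apply: le_trans (ler_normD _ _) _.
have -> : e * (L1 + L2) = e / 2 * L1 + e / 2 * L2 + e / 2 * (L1 + L2) by field.
apply: lerD; last by rewrite normrM -[leRHS]mulr1 ler_pM.
apply: le_trans (ler_normD _ _) _.
by rewrite !normrM (gtr0_norm L1_gt0) (gtr0_norm L2_gt0) lerD // ler_pM2r.
Qed.

(** Serves cache size and rate alike: [x] exceeds its ideal value [y * L / k] by at most [z] bits,
    and [z] will not depend on [L]. *)
Lemma ratio_close (R : realFieldType) (x y z k L : nat) (e : R) :
    (0 < k)%N -> (0 < L)%N -> (y * L <= x * k <= y * L + z * k)%N ->
    z%:R <= e * L%:R ->
  `|x%:R / L%:R - y%:R / k%:R| <= e.
Proof.
move=> k_gt0 L_gt0 /andP[]; rewrite -!(ler_nat R) natrD !natrM => lo up le_z.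
have k0 : 0 < k%:R :> R by rewrite ltr0n.
have L0 : 0 < L%:R :> R by rewrite ltr0n.
have -> : x%:R / L%:R - y%:R / k%:R =
    (x%:R * k%:R - y%:R * L%:R) / (k%:R * L%:R) :> R.
  by field; rewrite !lt0r_neq0.
rewrite ger0_norm; last first.
  by rewrite divr_ge0 ?subr_ge0 // mulr_ge0 // ltW.
rewrite ler_pdivrMr ?mulr_gt0 // lerBlDl; apply: le_trans up _.
by rewrite lerD2l mulrCA mulrC ler_pM2l.
Qed.

Lemma eventually_leM (R : archiRealFieldType) (x y : R) : 0 <= x -> 0 < y ->
  exists L0 : nat, forall L : nat, (L0 <= L)%N -> x <= y * L%:R.
Proof.
move=> x_ge0 y_gt0; exists (Num.bound (x / y)) => L leL.
rewrite mulrC -ler_pdivrMr // ltW // (lt_le_trans (archi_boundP _)) ?ler_nat //.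
by rewrite divr_ge0 // ltW.
Qed.

Lemma achievable_mix (R : realType) (K K' N : nat) (p q : R * R) (l : R) :
    0 < l -> l < 1 -> achievable R K K' N p -> achievable R K K' N q ->
  achievable R K K' N (l * p.1 + (1 - l) * q.1, l * p.2 + (1 - l) * q.2).
Proof.
move=> l_gt0 l_lt1 achp achq e e_gt0.
have e2_gt0 : 0 < e / 2 by rewrite divr_gt0.
have l'_gt0 : 0 < 1 - l by rewrite subr_gt0.
have [Lp Lp_ok] := achp _ e2_gt0; have [Lq Lq_ok] := achq _ e2_gt0.
(* The successors give [Lp < L1] and [Lq < L2] despite rounding, so both parts are nonempty and long
   enough for their schemes. *)
have [Ma Ma_ok] := eventually_leM (ler0n R Lp.+1) l_gt0.
have [Mb Mb_ok] := eventually_leM (ler0n R Lq.+1) l'_gt0.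
have [Mc Mc_ok] := eventually_leM (normr_ge0 (N%:R * p.1 - N%:R * q.1)) e2_gt0.
have [Md Md_ok] := eventually_leM (normr_ge0 (p.2 - q.2)) e2_gt0.
exists (maxn (maxn Ma Mb) (maxn Mc Md)) => L.
rewrite !geq_max => /andP[/andP[/Ma_ok leLp /Mb_ok leLq]].
move=> /andP[/Mc_ok le1 /Md_ok le2].
have lL_ge0 : 0 <= l * L%:R by rewrite mulr_ge0 // ltW.
pose L1 := Num.truncn (l * L%:R); pose L2 := (L - L1)%N.
have /andP[L1_le L1_gt] := truncn_itv lL_ge0.
have L1_leL : (L1 <= L)%N.
  rewrite -(ler_nat R) (le_trans L1_le) // ler_piMl //; exact: ltW.
have LE : L = (L1 + L2)%N by rewrite subnKC.
have LER : L1%:R + L2%:R = L%:R :> R by rewrite -natrD -LE.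
have lt1 : (Lp < L1)%N by rewrite -ltnS -(ltr_nat R); apply: le_lt_trans L1_gt.
have lt2 : (Lq < L2)%N.
  rewrite -(ler_nat R) (le_trans leLq) // natrB //.
  by rewrite mulrBl mul1r lerD2l lerN2.
have [c1 [r1 [cN1 cl1 rl1 [pl1 [dl1 [dc1 ok1]]]]]] := Lp_ok _ (ltnW lt1).
have [c2 [r2 [cN2 cl2 rl2 [pl2 [dl2 [dc2 ok2]]]]]] := Lq_ok _ (ltnW lt2).
have pos1 : 0 < L1%:R :> R by rewrite ltr0n (leq_ltn_trans _ lt1).
have pos2 : 0 < L2%:R :> R by rewrite ltr0n (leq_ltn_trans _ lt2).
have closeL : `|L1%:R - l * L%:R| <= 1.
  rewrite ler_norml; move: L1_gt; rewrite -natr1 => L1_gt.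
  by apply/andP; split; rewrite -/L1 in L1_gt L1_le; lra.
exists (c1 + c2)%N, (r1 + r2)%N; rewrite LE; split => /=.
- by rewrite mulnDr leq_add.
- rewrite !natrD (_ : N%:R * _ = l * (N%:R * p.1) + (1 - l) * (N%:R * q.1)).
    by apply: mix_close; rewrite ?LER.
  by ring.
- by rewrite !natrD; apply: mix_close; rewrite ?LER.
- exact: split_hotplug_scheme ok1 ok2.
Qed.

Lemma convex_achievable (R : realType) (K K' N : nat) :
  @convex_set R (R^o * R^o)%type (achievable R K K' N).
Proof.
apply/convex_setW => p q /set_mem achp /set_mem achq l l_gt0 l_lt1.
apply: mem_set; exact: (achievable_mix l_gt0 l_lt1 achp achq).
Qed.

(** * Achievability of the points and of their envelope *)

Lemma hotplug_pointE (R : realType) (K K' t : nat) :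
    (0 < K')%N -> (K' <= K)%N -> (bin_pred K.-1 t <= 'C(K', t))%N ->
  hotplug_point R K K' t =
    ((bin_pred K.-1 t)%:R / 'C(K', t)%:R,
     ('C(K', t.+1) - K' %/ t.+1 * skipped K K' t)%:R / 'C(K', t)%:R).
Proof.
move=> K'_gt0 le_K'K le_k; rewrite /hotplug_point natrB ?leq_skipped //.
have := leq_bin_pred t (leq_sub2r 1 le_K'K); rewrite !subn1 => le_pred.
by rewrite natrM natrB.
Qed.

Lemma achievable_hotplug_point (R : realType) (K K' N t : nat) :
    (0 < K')%N -> (K' <= K)%N -> (t <= K')%N ->
    (bin_pred K.-1 t <= 'C(K', t))%N ->
  achievable R K K' N (hotplug_point R K K' t).
Proof.
move=> K'_gt0 le_K'K le_tK' le_k; rewrite hotplug_pointE // => e e_gt0 /=.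
have k_gt0 : (0 < 'C(K', t))%N by rewrite bin_gt0.
set k := 'C(K', t) in le_k k_gt0 *; set B := bin_pred K.-1 t in le_k *.
set E := (_ - _)%N; pose A := #|request K N|.
(* Rounding up the piece length costs at most one bit per stored piece, [N * B] in all, and one per
   multicast, [E] in all; the request adds [A] bits. *)
have [Ma Ma_ok] := eventually_leM (ler0n R (N * B)) e_gt0.
have [Mb Mb_ok] := eventually_leM (ler0n R (A + E)) e_gt0.
exists (maxn (K * k).+1 (maxn Ma Mb)) => L.
rewrite !geq_max => /and3P[le_KL /Ma_ok leNB /Mb_ok leAE].
have L_gt0 : (0 < L)%N by apply: leq_ltn_trans le_KL.
(* The piece length, just above [L / k]; the bound [K * k < L] makes it at least [K], as the code
   requires. *)
pose m := (L %/ k).+1.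
have le_Km : (K <= m)%N by rewrite ltnW // ltnS leq_divRL // ltnW.
have lo : (L <= m * k)%N by rewrite ltnW // -ltn_divLR.
have up : (m * k <= L + k)%N by rewrite mulSn addnC leq_add2r leq_trunc_div.
exists (minn (m * (N * B)) (N * L)), (A + m * E)%N; split.
- exact: geq_minr.
- rewrite mulrA -natrM; apply: ratio_close leNB => //.
  (* For the uncoded library the lower bound reduces to [B <= k], that is M <= N. *)
  rewrite minnMl leq_min geq_min -mulnDr.
  rewrite (_ : m * (N * B) * k = N * B * (m * k))%N; last first.
    by rewrite mulnAC mulnC.
  by rewrite !leq_mul2l lo up mulnAC leq_mul2l le_k !orbT.
- apply: ratio_close leAE => //.
  rewrite mulnDl mulnAC [(m * k * E)%N]mulnC (mulnDl A E) addnCA -mulnDr.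
  rewrite leq_add2l leq_mul2l up orbT andbT.
  by rewrite (leq_trans _ (leq_addl _ _)) // leq_mul2l lo orbT.
- exact: coded_hotplug_scheme.
Qed.

Local Open Scope classical_set_scope.

Theorem theorem5 (R : realType) (K K' N : nat)
    (K'_gt0 : (1 <= K')%N) (K'_leK : (K' <= K)%N) (N_gt0 : (1 <= N)%N) :
  lower_convex_envelope (hotplug_points R K K') `<=` achievable R K K' N.
Proof.
move=> p [+ _]; move: p; apply: smallest_sub.
  exact: convex_achievable.
by move=> _ [t [le_tK' le_k] <-]; apply: achievable_hotplug_point.
Qed.
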